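(* Let $\mathcal Y=\{0,1\}$ and $\ell(y,y')=\mathbf 1_{y\ne y'}$. Let $L\in[0,1/2]$, $n\in\mathbb N$, and let $\mathcal G$ be a set of prediction functions of VC-dimension $V\ge2$. Let $\mathcal P_L$ be the set of probability distributions on $\mathcal X\times\{0,1\}$ such that $\inf_{g\in\mathcal G}R(g)=L$. For any estimator $\hat g$: (i) when $L=0$, there exists a distribution in $\mathcal P_0$ for which $$\mathbb ER(\hat g)-\inf_{g\in\mathcal G}R(g)\ge\begin{cases}\frac{V-1}{2e(n+1)}&\text{when }n\ge V-2,\\ \frac12\big(1-\frac1V\big)^n&\text{otherwise;}\end{cases}$$ (ii) when $0<L\le1/2$, there exists a distribution in $\mathcal P_L$ for which $$\mathbb ER(\hat g)-\inf_{g\in\mathcal G}R(g)\ge\begin{cases}\max\Big(\sqrt{\frac{L(V-1)}{32n}},\ \frac{2(V-1)}{27n}\Big)&\text{when }\frac{(1-2L)^2n}V\ge\frac49,\\ \frac{1-2L}6&\text{otherwise;}\end{cases}$$ (iii) there exists a probability distribution on $\mathcal X\times\{0,1\}$ for which $$\mathbb ER(\hat g)-\inf_{g\in\mathcal G}R(g)\ge\frac18\sqrt{\frac Vn}.$$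
   Context: A prediction function is a measurable map $\mathcal X\to\mathcal Y$. For a distribution $P$ on $\mathcal X\times\mathcal Y$, $R(g)=\mathbb E_{(X,Y)\sim P}\ell[Y,g(X)]$. An estimator maps a training set $Z_1^n\in(\mathcal X\times\mathcal Y)^n$ to a prediction function (measurably), and $\mathbb ER(\hat g)$ is its expected risk when $Z_1^n\sim P^{\otimes n}$ (the $n$-fold product of $P$), the risk being taken under the same $P$. The VC-dimension (Vapnik-Cervonenkis dimension) of $\mathcal G$ is the largest number of points of $\mathcal X$ on which the functions of $\mathcal G$ realize all possible $\{0,1\}$-labelings.
   Formalization: Part (iii) is stated only for V ≤ 13n (so n ≥ 1): without a restriction it is false, since the excess risk is at most 1 while (1/8)√(V/n) exceeds 1 when V > 64n, and it already fails for n = 1, V = 14 with X of 14 points and G all labelings. *)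

(* Defs.v *)
From HB Require Import structures.
From mathcomp Require Import all_boot all_order all_algebra.
From mathcomp Require Import all_classical all_reals all_analysis.

Set Implicit Arguments.
Unset Strict Implicit.
Unset Printing Implicit Defensive.

Import Order.TTheory GRing.Theory Num.Theory.
Import numFieldNormedType.Exports.

Local Open Scope classical_set_scope.
Local Open Scope ring_scope.

Section product_distribution.
Context d (Z : measurableType d) (R : realType).

Definition tuple_cons n (p : Z * n.-tuple Z) : n.+1.-tuple Z :=
  [tuple of p.1 :: p.2].

Lemma measurable_tuple_cons n : measurable_fun setT (@tuple_cons n).
Proof. exact: measurable_cons measurable_fst measurable_snd. Qed.

HB.instance Definition _ n :=
  isMeasurableFun.Build _ _ _ _ (@tuple_cons n) (@measurable_tuple_cons n).

(* The n-fold product P^{\otimes n}; iid_prob_box characterizes it. *)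
Fixpoint iid_prob (P : probability Z R) (n : nat) : probability (n.-tuple Z) R :=
  match n with
  | 0 => \d_([tuple] : 0.-tuple Z)
  | m.+1 => distribution (P \x iid_prob P m)%E (@tuple_cons m)
  end.

Lemma iid_prob_box (P : probability Z R) (n : nat) (A : 'I_n -> set Z) :
  (forall i, measurable (A i)) ->
  iid_prob P n [set z | forall i, A i (tnth z i)] = (\prod_(i < n) P (A i))%E.
Proof.
elim: n A => [|n IHn] A mA /=.
  by rewrite big_ord0 diracE mem_set//= => -[].
have mB : measurable [set z : n.-tuple Z | forall i, A (lift ord0 i) (tnth z i)].
  rewrite (_ : [set z | _] =
      \bigcap_(i in [set: 'I_n]) ((@tnth n Z)^~ i @^-1` A (lift ord0 i))).
    apply: fin_bigcap_measurable => // i _; rewrite -[X in measurable X]setTI.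
    exact: measurable_tnth.
  by apply/seteqP; split => z /= Hz i; [move=> _; exact: Hz|exact: Hz].
rewrite big_ord_recl -IHn// -product_measure1E//=.
rewrite /distribution /pushforward; congr product_measure1.
apply/seteqP; split => -[z0 z] /=.
  move=> Az; split=> [|i]; first by have := Az ord0; rewrite tnth0.
  by have := Az (lift ord0 i); rewrite tnthS.
move=> [A0 Az] i; have [j ->|->] := unliftP ord0 i; first by rewrite tnthS.
by rewrite tnth0.
Qed.

End product_distribution.

Section classification.
Context d (X : measurableType d) (R : realType).

(* Labels are booleans (true = 1, false = 0), with the discrete sigma-algebra;
   a prediction function is an element of {mfun X >-> bool}. *)

Definition loss (y y' : bool) : R := (y != y')%:R.

Definition risk (P : probability (X * bool)%type R) (g : X -> bool) : \bar R :=
  'E_P[fun z => loss z.2 (g z.1)].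

Definition best_risk (G : set {mfun X >-> bool})
    (P : probability (X * bool)%type R) : \bar R :=
  ereal_inf [set risk P g | g in G].

(* Joint measurability in the sample and the point makes the risk of the
   estimator a measurable function of the sample, for every P. *)
Definition is_estimator n (ghat : n.-tuple (X * bool) -> {mfun X >-> bool}) :=
  measurable_fun [set: n.-tuple (X * bool) * X] (fun zx => ghat zx.1 zx.2).

Definition expected_risk n (P : probability (X * bool)%type R)
    (ghat : n.-tuple (X * bool) -> {mfun X >-> bool}) : \bar R :=
  (\int[iid_prob P n]_z risk P (ghat z))%E.

Definition excess_risk n (G : set {mfun X >-> bool})
    (P : probability (X * bool)%type R)
    (ghat : n.-tuple (X * bool) -> {mfun X >-> bool}) : \bar R :=
  (expected_risk P ghat - best_risk G P)%E.

End classification.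

Section vc_dimension.
Context d (X : measurableType d).
Implicit Types G : set {mfun X >-> bool}.

Definition shatters_points G m :=
  exists x : 'I_m -> X, injective x /\
    forall b : 'I_m -> bool, exists2 g, G g & forall i, g (x i) = b i.

Definition is_vc_dimension G V :=
  shatters_points G V /\ forall m, shatters_points G m -> (m <= V)%N.

End vc_dimension.

(* Main.v *)
Require Import Defs.
From HB Require Import structures.
From mathcomp Require Import all_boot all_order all_algebra.
From mathcomp Require Import all_classical all_reals all_analysis.
From mathcomp Require Import measurable_realfun ring lra.

Set Implicit Arguments.
Unset Strict Implicit.
Unset Printing Implicit Defensive.

Import Order.TTheory GRing.Theory Num.Theory.
Import numFieldNormedType.Exports.

Local Open Scope classical_set_scope.
Local Open Scope ring_scope.

(* Put mass m_i on each point i of a shattered set and let its label agree with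
   s_i with probability (1 + x_i) / 2, where s is an unknown labeling.  As all
   labelings are realized in G, the best risk is that of s, and predicting i
   wrongly costs m_i x_i on top of it.  Averaging over uniform s, the estimator
   errs at i with probability at least half of \sum_t min(P_s(t), P_s'(t)), the
   sum running over the samples t and s' being s flipped at i; so some s is at
   least as bad.  That sum is at least (1 - m_i)^n, because i may be absent from
   the sample, and at least 1 - u as soon as n m_i x_i^2 <= u^2, because
   \sum_t (P_s - P_s')^2 / (P_s + P_s') grows by at most 2 m_i x_i^2 with each
   observation.  The bounds follow by tuning m and x, equal at all points except
   possibly one, which takes the remaining mass and adjusts the best risk. *)

(** * Peeling one observation off a sum over samples *)

Lemma big_tuple_cons (S : nmodType) (K : finType) n
    (F : n.+1.-tuple K -> S) :
  \sum_t F t = \sum_k \sum_(t : n.-tuple K) F [tuple of k :: t].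
Proof.
rewrite pair_bigA/= (reindex (fun p : K * n.-tuple K => [tuple of p.1 :: p.2]))//.
exists (fun t : n.+1.-tuple K => (thead t, [tuple of behead t])) => [[k t]|t] _ /=.
  by rewrite theadE; congr pair; apply/val_inj.
by rewrite [RHS]tuple_eta; apply/val_inj.
Qed.

(** * Triangular discrimination of two nonnegative weights *)

Section discrimination.
Context {R : realFieldType}.
Implicit Types p q x w t : R.

(** One term of the triangular (Vincze-Le Cam) discrimination. As [0^-1 = 0], it vanishes when p + q
    = 0. *)
Definition discr p q := (p - q) ^+ 2 / (p + q).

Lemma discrM w p q : discr (p * w) (q * w) = discr p q * w.
Proof.
rewrite /discr -mulrBl -mulrDl; have [->|w0] := eqVneq w 0.
  by rewrite !mulr0 invr0 mulr0.
have [->|s0] := eqVneq (p + q) 0; first by rewrite mul0r invr0 !mulr0 mul0r.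
by field; rewrite s0.
Qed.

Lemma discrE p q : 0 <= p -> 0 <= q -> discr p q = p + q - 4 * (p * q / (p + q)).
Proof.
move=> p0 q0; rewrite /discr; have [s0|s0] := eqVneq (p + q) 0.
  by rewrite s0 invr0 !mulr0 subr0.
by field.
Qed.

(** An observation at the flipped point scales the two weights by opposite factors 1 + x and 1 - x.
    By [discrE] the claim compares harmonic means; since u + v = 2s, it reduces to u v <= s^2 and 4
    p q <= s^2. *)
Lemma discr_sign p q x : 0 <= p -> 0 <= q -> 0 <= x <= 1 ->
  discr (p * (1 + x)) (q * (1 - x)) + discr (p * (1 - x)) (q * (1 + x)) <=
  2 * discr p q + 2 * x ^+ 2 * (p + q).
Proof.
move=> p0 q0 /andP[x0 x1]; rewrite !discrE ?mulr_ge0//; try lra.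
set u := p * (1 + x) + q * (1 - x); set v := p * (1 - x) + q * (1 + x).
set s := p + q.
have [s0|s0] := eqVneq s 0.
  have [pz qz] : p = 0 /\ q = 0 by rewrite /s in s0; split; lra.
  by rewrite /u /v /s pz qz !(mul0r, addr0, subr0, mulr0).
have sp : 0 < s by rewrite lt_neqAle eq_sym s0 addr_ge0.
have uvE : u + v = 2 * s by rewrite /u /v /s; ring.
suff H : 4 * (p * q / s) <= x ^+ 2 * s + 2 * (p * q * (1 - x ^+ 2)) * (u^-1 + v^-1).
  suff -> : u - 4 * (p * (1 + x) * (q * (1 - x)) / u) +
         (v - 4 * (p * (1 - x) * (q * (1 + x)) / v)) =
         2 * s - 2 * (2 * (p * q * (1 - x ^+ 2)) * (u^-1 + v^-1)) by lra.
  by rewrite -uvE; ring.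
have pq_le : 4 * (p * q) <= s ^+ 2.
  by rewrite -subr_ge0 /s (_ : _ - _ = (p - q) ^+ 2) ?sqr_ge0//; ring.
have x2 : x ^+ 2 <= 1 by rewrite expr_le1.
have pq0 : 0 <= p * q by rewrite mulr_ge0.
have upos : 0 < p -> 0 < u by rewrite /u; nra.
have vpos : 0 < q -> 0 < v by rewrite /v; nra.
have step : 4 * (p * q / s) <= x ^+ 2 * s + 4 * (p * q) * (1 - x ^+ 2) / s.
  rewrite mulrA ler_pdivrMr//.
  have -> : (x ^+ 2 * s + 4 * (p * q) * (1 - x ^+ 2) / s) * s =
    x ^+ 2 * s ^+ 2 + 4 * (p * q) * (1 - x ^+ 2) by field.
  have : 0 <= x ^+ 2 by apply: sqr_ge0.
  nra.
apply: (le_trans step); rewrite lerD2l.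
(* When p or q is zero, u or v may vanish, but both sides are then zero. *)
have [->|pz] := eqVneq p 0; first by rewrite !(mul0r, mulr0).
have [->|qz] := eqVneq q 0; first by rewrite !(mul0r, mulr0).
have u0 : 0 < u by apply: upos; rewrite lt_neqAle eq_sym pz.
have v0 : 0 < v by apply: vpos; rewrite lt_neqAle eq_sym qz.
have -> : 4 * (p * q) * (1 - x ^+ 2) / s =
   2 * (p * q * (1 - x ^+ 2)) * (2 / s) by ring.
apply: ler_wpM2l; first by rewrite !mulr_ge0// subr_ge0.
have -> : u^-1 + v^-1 = 2 * s / (u * v) by rewrite -uvE; field; rewrite !gt_eqF.
rewrite ler_pdivrMr// mulrAC ler_pdivlMr ?mulr_gt0//.
suff : u * v <= s * s by lra.
have -> : u * v = s * s - ((u - v) / 2) ^+ 2.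
  have -> : s = (u + v) / 2 by lra.
  by field.
by rewrite gerBl sqr_ge0.
Qed.

(* AM-GM: |p - q| = sqrt (p + q) * sqrt (discr p q). *)
Lemma minr_discr p q t : 0 <= p -> 0 <= q -> 0 < t ->
  (p + q) * (1 / 2 - t / 4) - discr p q / (4 * t) <= Num.min p q.
Proof.
wlog : p q / p <= q => [wlg|pq p0 q0 t0].
  move=> p0 q0 t0; have /orP[pq|qp] := le_total p q; first exact: wlg.
  rewrite minC (addrC p) (_ : discr p q = discr q p) ?wlg//.
  by rewrite /discr -(opprB q) sqrrN (addrC p q).
have [s0|s0] := eqVneq (p + q) 0.
  have [-> ->] : p = 0 /\ q = 0 by split; lra.
  by rewrite minxx /discr !(mul0r, addr0, subrr, expr0n, mulr0)/=.
have sp : 0 < p + q by rewrite lt_neqAle eq_sym s0 addr_ge0.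
rewrite min_l// /discr -subr_ge0.
have -> : p - ((p + q) * (1 / 2 - t / 4) - (p - q) ^+ 2 / (p + q) / (4 * t)) =
   (t * (p + q) - (q - p)) ^+ 2 / (4 * t * (p + q)).
  by field; rewrite s0 gt_eqF.
by rewrite divr_ge0 ?sqr_ge0// !mulr_ge0// ltW.
Qed.

End discrimination.

(** * Samples from the finite model and the averaging argument *)

Section sampling.
Context {R : realFieldType} (I : finType).
Local Notation K := (I * bool)%type.
Implicit Types (m x : I -> R) (s : {ffun I -> bool}) (i : I).

Definition cell m x s (k : K) : R :=
  m k.1 * (1 + (if k.2 == s k.1 then x k.1 else - x k.1)) / 2.

Definition flip i s : {ffun I -> bool} := [ffun j => (j == i) (+) s j].

Definition weight n m x s (t : n.-tuple K) : R := \prod_(k <- t) cell m x s k.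

Lemma flipK i : involutive (flip i).
Proof. by move=> s; apply/ffunP => j; rewrite !ffunE addbA addbb. Qed.

Lemma big_pair_fst (i : I) (F : K -> R) :
  \sum_(k | k.1 == i) F k = F (i, true) + F (i, false).
Proof.
transitivity (\sum_(j | j == i) \sum_b F (j, b)).
  by rewrite pair_big/=; apply: eq_big => [[j b]|[j b] _]; rewrite ?andbT.
by rewrite big_pred1_eq big_bool.
Qed.

Section model.
Context (m x : I -> R).
Hypotheses (m0 : forall i, 0 <= m i) (m1 : \sum_i m i = 1).
Hypothesis (x01 : forall i, 0 <= x i <= 1).

Lemma cell_ge0 s k : 0 <= cell m x s k.
Proof.
rewrite /cell divr_ge0// mulr_ge0//; have /andP[] := x01 k.1.
by case: ifP => _; lra.
Qed.

Lemma sum_cell (s : {ffun I -> bool}) (f : K -> R) :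
  \sum_k cell m x s k * f k =
  \sum_i m i / 2 * ((1 + x i) * f (i, s i) + (1 - x i) * f (i, ~~ s i)).
Proof.
transitivity (\sum_i \sum_b cell m x s (i, b) * f (i, b)).
  by rewrite pair_bigA; apply: eq_bigr => -[].
apply: eq_bigr => i _; rewrite big_bool /cell/=.
by case: (s i) => /=; field.
Qed.

Lemma sum_cell1 s : \sum_k cell m x s k = 1.
Proof.
under eq_bigr do rewrite -[cell _ _ _ _]mulr1.
rewrite (sum_cell s (fun=> 1)) -[RHS]m1.
by apply: eq_bigr => i _ /=; field.
Qed.

Lemma weight_ge0 n s (t : n.-tuple K) : 0 <= weight m x s t.
Proof. by rewrite /weight; apply: prodr_ge0 => k _; exact: cell_ge0. Qed.

Lemma weight_cons n s k (t : n.-tuple K) :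
  weight m x s [tuple of k :: t] = weight m x s t * cell m x s k.
Proof. by rewrite /weight big_cons mulrC. Qed.

Lemma weight0 s (t : 0.-tuple K) : weight m x s t = 1.
Proof. by rewrite /weight tuple0 big_nil. Qed.

Lemma sum_tuple0 (F : 0.-tuple K -> R) : \sum_t F t = F [tuple].
Proof.
rewrite (bigD1 [tuple])//= big1 ?addr0// => t.
by move=> /eqP []; exact: tuple0.
Qed.

Lemma sum_weight n s : \sum_(t : n.-tuple K) weight m x s t = 1.
Proof.
elim: n => [|n IH]; first by rewrite sum_tuple0 weight0.
rewrite big_tuple_cons exchange_big/= -IH; apply: eq_bigr => t _.
under eq_bigr do rewrite weight_cons.
by rewrite -mulr_sumr sum_cell1 mulr1.
Qed.

Lemma cell_flip i s k : k.1 != i -> cell m x (flip i s) k = cell m x s k.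
Proof. by rewrite /cell ffunE => /negbTE ->. Qed.

Lemma sum_cell_neq i s : \sum_(k | k.1 != i) cell m x s k = 1 - m i.
Proof.
apply/eqP; rewrite eq_sym subr_eq -(sum_cell1 s) (bigID (fun k : K => k.1 == i))/=.
rewrite addrC; apply/eqP; congr (_ + _).
by rewrite big_pair_fst /cell /=; case: (s i) => /=; field.
Qed.

(** By induction: an observation away from i has the same probability under both labelings and
    factors out of the minimum; observations at i are discarded. *)
Lemma sum_min_weight n i s :
  (1 - m i) ^+ n <=
  \sum_(t : n.-tuple K) Num.min (weight m x s t) (weight m x (flip i s) t).
Proof.
elim: n => [|n IH]; first by rewrite sum_tuple0 !weight0 minxx.
rewrite big_tuple_cons exchange_big/= exprSr.
have m1i : 0 <= 1 - m i by rewrite -(sum_cell_neq i s) sumr_ge0// => k _; exact: cell_ge0.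
apply: (le_trans (ler_wpM2r m1i IH)); rewrite mulr_suml; apply: ler_sum => t _.
rewrite -(sum_cell_neq i s) mulr_sumr [leRHS](bigID (fun k : K => k.1 != i))/=.
have -> : \sum_(k | k.1 != i) Num.min (weight m x s t) (weight m x (flip i s) t) *
    cell m x s k = \sum_(k | k.1 != i) Num.min (weight m x s [tuple of k :: t])
      (weight m x (flip i s) [tuple of k :: t]).
  apply: eq_bigr => k ki; rewrite !weight_cons cell_flip//.
  by rewrite -minr_pMl ?cell_ge0.
rewrite lerDl sumr_ge0// => k _.
by rewrite le_min !weight_ge0.
Qed.

(** By induction: observations away from i keep a fraction 1 - m_i of the discrimination. Those at i
    restore the missing m_i and add m_i x_i^2 (p + q), which sums to 2 m_i x_i^2 over the
    samples. *)
Lemma sum_discr_weight n i s :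
  \sum_(t : n.-tuple K) discr (weight m x s t) (weight m x (flip i s) t) <=
  2 * (n%:R * m i * x i ^+ 2).
Proof.
elim: n => [|n IH].
  by rewrite sum_tuple0 !weight0 /discr subrr expr0n !(mul0r, mulr0).
rewrite big_tuple_cons exchange_big/=.
suff step (t : n.-tuple K) : \sum_k discr (weight m x s [tuple of k :: t])
      (weight m x (flip i s) [tuple of k :: t]) <=
    discr (weight m x s t) (weight m x (flip i s) t) +
    m i * x i ^+ 2 * (weight m x s t + weight m x (flip i s) t).
  apply: (le_trans (ler_sum _ (fun t _ => step t))).
  rewrite big_split/= -mulr_sumr big_split/= !sum_weight.
  by rewrite (le_trans (lerD IH (lexx _)))// -natr1; lra.
set p := weight m x s t; set q := weight m x (flip i s) t.
rewrite (bigID (fun k : K => k.1 != i))/=.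
have -> : \sum_(k | k.1 != i) discr (weight m x s [tuple of k :: t])
    (weight m x (flip i s) [tuple of k :: t]) = discr p q * (1 - m i).
  rewrite -(sum_cell_neq i s) mulr_sumr; apply: eq_bigr => k ki.
  by rewrite !weight_cons cell_flip// discrM.
rewrite (eq_bigl (fun k : K => k.1 == i)); last by move=> k; rewrite negbK.
rewrite big_pair_fst.
have H := discr_sign (weight_ge0 s t) (weight_ge0 (flip i s) t) (x01 i).
have {H} := ler_wpM2r (divr_ge0 (m0 i) (ler0n R 2)) H.
rewrite [leLHS]mulrDl -2![in leLHS]discrM => H.
apply: (@le_trans _ _ (discr p q * (1 - m i) +
  (2 * discr p q + 2 * x i ^+ 2 * (p + q)) * (m i / 2))); last by lra.
rewrite lerD2l (le_trans _ H)// !weight_cons -/p -/q /cell/= !ffunE eqxx/=.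
have assoc (y z : R) : y * (m i * z / 2) = y * z * (m i / 2) by ring.
by case: (s i) => /=; rewrite !assoc // addrC.
Qed.

(** Summing [minr_discr] with t = u loses u / 2 twice: once from the term t / 4 on total mass 2,
    once from a discrimination of at most 2 u^2 divided by 4 u. *)
Lemma sum_min_weight_discr n i s u : 0 < u -> n%:R * m i * x i ^+ 2 <= u ^+ 2 ->
  1 - u <=
  \sum_(t : n.-tuple K) Num.min (weight m x s t) (weight m x (flip i s) t).
Proof.
move=> u0 nu.
apply: (le_trans _ (ler_sum _ (fun t _ =>
  minr_discr (weight_ge0 s t) (weight_ge0 (flip i s) t) u0))).
rewrite sumrB -mulr_suml big_split/= !sum_weight -mulr_suml.
have : (\sum_(t : n.-tuple K) discr (weight m x s t) (weight m x (flip i s) t)) /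
    (4 * u) <= u / 2.
  rewrite ler_pdivrMr ?mulr_gt0//; apply: (le_trans (sum_discr_weight n i s)).
  rewrite expr2 in nu; lra.
lra.
Qed.

Lemma exists_labeling n (F : n.-tuple K -> I -> bool) (beta : I -> R) :
  (forall i s, beta i <= \sum_(t : n.-tuple K)
     Num.min (weight m x s t) (weight m x (flip i s) t)) ->
  exists s, \sum_i m i * x i * beta i / 2 <=
    \sum_(t : n.-tuple K)
      weight m x s t * \sum_i m i * x i * (F t i != s i)%:R.
Proof.
move=> Hb; apply/existsP; apply: contraT; rewrite negb_exists => /forallP H.
pose e s i := \sum_(t : n.-tuple K) weight m x s t * (F t i != s i)%:R.
(* The guess [F t i] is wrong for exactly one of s and its flip, so each sample contributes at least
   the smaller weight. *)
have e_ge s i : beta i <= e s i + e (flip i s) i.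
  apply: (le_trans (Hb i s)); rewrite -big_split/=; apply: ler_sum => t _.
  rewrite ffunE eqxx/=; case: (F t i); case: (s i) => /=;
    by rewrite ?mulr0 ?mulr1 ?addr0 ?add0r ge_min lexx ?orbT.
have eE s : \sum_(t : n.-tuple K)
      weight m x s t * \sum_i m i * x i * (F t i != s i)%:R =
    \sum_i m i * x i * e s i.
  under eq_bigr do rewrite mulr_sumr.
  rewrite exchange_big/=; apply: eq_bigr => i _; rewrite mulr_sumr.
  by apply: eq_bigr => t _; rewrite mulrCA.
have lt_sum : \sum_s \sum_i m i * x i * e s i <
    \sum_(s : {ffun I -> bool}) \sum_i m i * x i * beta i / 2.
  apply: ltr_sum => [|s _].
    (* Strictness of the sum requires at least one labeling. *)
    by apply/hasP; exists [ffun=> true]; rewrite ?mem_index_enum.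
  by rewrite -eE ltNge H.
suff : \sum_(s : {ffun I -> bool}) \sum_i m i * x i * beta i / 2 <=
       \sum_s \sum_i m i * x i * e s i by rewrite leNgt lt_sum.
rewrite exchange_big [leRHS]exchange_big/=; apply: ler_sum => i _.
rewrite -[leRHS]mulr_sumr.
(* Flipping at i permutes the labelings, so s may be paired with its flip. *)
have -> : \sum_s e s i = \sum_s (e s i + e (flip i s) i) / 2.
  rewrite -mulr_suml big_split/=.
  by rewrite (reindex_inj (inv_inj (flipK i)))/=; field.
rewrite mulr_sumr; apply: ler_sum => s _.
have : 0 <= m i * x i by rewrite mulr_ge0//; have /andP[] := x01 i.
by move=> /ler_wpM2l /(_ _ _ (e_ge s i)); lra.
Qed.

End model.
End sampling.

(** * Finitely supported probabilities and their product samples *)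

Section finite_support.
Context d (T : measurableType d) (R : realType) (K : finType).
Context (a : K -> T) (c : K -> R).
Hypotheses (c0 : forall k, 0 <= c k) (c1 : \sum_k c k = 1).
Local Open Scope ereal_scope.

(** [msum] takes a sequence, so K is enumerated and the sequence is padded with the zero measure. *)
Let atom (j : nat) : {measure set T -> \bar R} :=
  if insub j is Some i then
    mscale (NngNum (c0 (@enum_val K predT i))) \d_(a (enum_val i))
  else mzero.

Lemma exists_finite_support : exists P : probability T R,
  forall f : T -> \bar R, measurable_fun setT f -> (forall t, 0 <= f t) ->
  \int[P]_t f t = \sum_k (c k)%:E * f (a k).
Proof.
pose mu := msum atom #|K|.
have muE f : measurable_fun setT f -> (forall t, 0 <= f t) ->
    \int[mu]_t f t = \sum_k (c k)%:E * f (a k).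
  move=> mf f0; rewrite ge0_integral_measure_sum//.
  rewrite (reindex (@enum_val K predT))/=; last first.
    exact: onW_bij (@enum_val_bij _).
  apply: eq_bigr => i _; rewrite /atom valK ge0_integral_mscale//=.
  by rewrite integral_dirac// diracT mul1e.
have mu1 : mu setT = 1.
  rewrite -[LHS]mul1e -(integral_cst mu measurableT) muE//.
  rewrite (eq_bigr (EFin \o c)) => [|k _]; last by rewrite mule1.
  by rewrite sumEFin c1.
pose mixin := @Measure_isProbability.Build _ _ _ mu mu1.
by exists (HB.pack_for (probability T R) mu mixin).
Qed.

End finite_support.

Section finite_support_sampling.
Context d (T : measurableType d) (R : realType) (K : finType).
Context (a : K -> T) (c : K -> R) (P : probability T R).
Hypothesis PE : forall f : T -> \bar R,
  measurable_fun setT f -> (forall t, (0 <= f t)%E) ->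
  (\int[P]_t f t = \sum_k (c k)%:E * f (a k))%E.
Hypothesis c0 : forall k, 0 <= c k.
Local Open Scope ereal_scope.

(** Tonelli separates the first observation, which is integrated by [PE]; the rest is the induction
    hypothesis. *)
Lemma integral_iid_prob n (f : n.-tuple T -> \bar R) :
  measurable_fun setT f -> (forall z, 0 <= f z) ->
  \int[iid_prob P n]_z f z =
  \sum_(t : n.-tuple K) (\prod_(k <- t) c k)%:E * f [tuple of map a t].
Proof.
elim: n f => [|n IH] f mf f0.
  rewrite /= integral_dirac// diracT mul1e.
  rewrite (bigD1 [tuple])//= big_nil big1 => [|t]; last first.
    by move=> /eqP []; exact: tuple0.
  by rewrite adde0 mul1e; congr f; apply: val_inj.
have mcons : measurable_fun setT (f \o @tuple_cons _ T n).
  by apply: measurableT_comp => //; exact: measurable_tuple_cons.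
rewrite /= ge0_integral_distribution// fubini_tonelli1//; last first.
  by move=> z; exact: f0.
rewrite PE; first last.
- by move=> t; apply: integral_ge0 => z _; exact: f0.
- by apply: measurable_fun_fubini_tonelli_F => // z; exact: f0.
rewrite big_tuple_cons; apply: eq_bigr => k _.
rewrite /fubini_F IH; first last.
- by move=> z; exact: f0.
- exact: (measurableT_comp mcons (pair1_measurable (a k))).
rewrite ge0_sume_distrr; last first.
  by move=> t _; apply: mule_ge0; [rewrite lee_fin prodr_ge0|exact: f0].
apply: eq_bigr => t _; rewrite big_cons EFinM muleA; congr (_ * f _).
exact: val_inj.
Qed.

End finite_support_sampling.

(** * From the finite model to the excess risk *)

Section excess.
Context d (X : measurableType d) (R : realType).
Context (G : set {mfun X >-> bool}) (I : finType) (pt : I -> X).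
Hypothesis shatter : forall b : I -> bool, exists2 g, G g & forall i, g (pt i) = b i.
Context n (ghat : n.-tuple (X * bool) -> {mfun X >-> bool}).
Hypothesis mghat : is_estimator ghat.
Context (m x : I -> R).
Hypotheses (m0 : forall i, 0 <= m i) (m1 : \sum_i m i = 1).
Hypothesis (x01 : forall i, 0 <= x i <= 1).

(** Under P all samples consist of atoms and only predictions at the points [pt i] count, so the
    estimator becomes a finite rule to which [exists_labeling] applies. *)
Lemma excess_risk_ge (beta : I -> R) :
  (forall i s, beta i <= \sum_(t : n.-tuple (I * bool))
     Num.min (weight m x s t) (weight m x (flip i s) t)) ->
  exists P : probability (X * bool)%type R,
    best_risk G P = (\sum_i m i * (1 - x i) / 2)%:E /\
    ((\sum_i m i * x i * beta i / 2)%:E <= excess_risk G P ghat)%E.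
Proof.
pose atom (k : I * bool) : X * bool := (pt k.1, k.2).
move=> Hbeta; have [s Hs] := exists_labeling m0 x01
  (fun (t : n.-tuple (I * bool)) i => ghat [tuple of map atom t] (pt i)) Hbeta.
have [P PE] := exists_finite_support atom (cell_ge0 m0 x01 s) (sum_cell1 x m1 s).
pose bayes := \sum_i m i * (1 - x i) / 2.
(* At i, agreeing with s errs with probability (1 - x_i) / 2 and disagreeing with (1 + x_i) / 2; the
   difference is x_i. *)
have riskE (g : {mfun X >-> bool}) :
    risk P g = (bayes + \sum_i m i * x i * (g (pt i) != s i)%:R)%:E.
  rewrite /risk unlock PE; last by move=> t; rewrite lee_fin ler0n.
    under eq_bigr do rewrite -EFinM.
    rewrite sumEFin (sum_cell m x s (fun k => loss R k.2 (g (pt k.1)))).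
    congr EFin; rewrite /bayes -big_split/=; apply: eq_bigr => i _.
    by rewrite /loss/=; case: (s i); case: (g (pt i)) => /=; field.
  apply/measurable_EFinP.
  have mb (h : bool -> R) : measurable_fun setT (fun y => h (g y)).
    exact: (measurableT_comp (f := h)).
  (* Splitting on the label leaves functions of the point alone. *)
  rewrite (_ : (fun z => _) =
      fun z : X * bool => if z.2 then (~~ g z.1)%:R else (g z.1)%:R).
    exact: (measurable_fun_if_pair (mb (fun b => (~~ b)%:R)) (mb (fun b => b%:R))).
  by apply/funext => -[y []]; rewrite /loss/=; case: (g y).
exists P; have best : best_risk G P = bayes%:E.
  apply/eqP; rewrite eq_le; apply/andP; split.
    have [g Gg gs] := shatter s.
    apply: ereal_inf_lbound; exists g => //; rewrite riskE big1 ?addr0// => i _.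
    by rewrite gs eqxx mulr0.
  apply: le_ereal_inf_tmp => _ [g _ <-]; rewrite riskE lee_fin lerDl.
  apply: sumr_ge0 => i _; rewrite !mulr_ge0//.
  by have /andP[] := x01 i.
split => //; rewrite /excess_risk best /expected_risk.
have mghat_pt y : measurable_fun setT (fun z => ghat z y).
  exact: (measurableT_comp mghat (pair2_measurable y)).
rewrite (integral_iid_prob PE (cell_ge0 m0 x01 s)); first last.
- move=> z; rewrite riskE lee_fin addr_ge0// sumr_ge0// => i _; have /andP[] := x01 i.
    by move=> _ x1; rewrite divr_ge0// mulr_ge0// subr_ge0.
  by move=> x0 _; rewrite !mulr_ge0.
- under eq_fun do rewrite riskE.
  apply/measurable_EFinP; apply: measurable_funD => //.
  apply: measurable_sum => i; apply: measurable_funM => //.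
  exact: (measurableT_comp (f := fun b : bool => (b != s i)%:R : R)).
rewrite (eq_bigr (fun t : n.-tuple (I * bool) => (weight m x s t * (bayes +
    \sum_i m i * x i * (ghat [tuple of map atom t] (pt i) != s i)%:R))%:E)).
  rewrite sumEFin -EFinB lee_fin (le_trans Hs)//.
  (* The constant [bayes] averages to itself and cancels the best risk. *)
  under [in leRHS]eq_bigr do rewrite mulrDr.
  by rewrite big_split/= -mulr_suml (sum_weight x m1 n s) mul1r addrAC subrr add0r.
by move=> t _; rewrite riskE -EFinM.
Qed.

End excess.

(** * Two choices of masses and biases *)

Section designs.
Context d (X : measurableType d) (R : realType).
Context (G : set {mfun X >-> bool}) (v : nat) (pt : 'I_v.+1 -> X).
Hypothesis shatter :
  forall b : 'I_v.+1 -> bool, exists2 g, G g & forall i, g (pt i) = b i.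
Context n (ghat : n.-tuple (X * bool) -> {mfun X >-> bool}).
Hypothesis mghat : is_estimator ghat.

(* [b] bounds from below the affinity between the laws of [n]-samples for two
   labelings differing at one point of mass [w] with label bias [x]. *)
Definition affinity_bound (w x b : R) : Prop :=
  b <= (1 - w) ^+ n \/
  exists2 u, 0 < u & n%:R * w * x ^+ 2 <= u ^+ 2 /\ b <= 1 - u.

Lemma affinity_boundP (I : finType) (m x : I -> R) i s b :
  (forall i, 0 <= m i) -> \sum_i m i = 1 -> (forall i, 0 <= x i <= 1) ->
  affinity_bound (m i) (x i) b ->
  b <= \sum_(t : n.-tuple (I * bool))
    Num.min (weight m x s t) (weight m x (flip i s) t).
Proof.
move=> m0 m1 x01 [bw|[u u0 [nu bu]]].
  exact: (le_trans bw (sum_min_weight m0 m1 x01 n i s)).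
exact: (le_trans bu (sum_min_weight_discr m0 m1 x01 s u0 nu)).
Qed.

Lemma excess_risk_uniform (x b : R) : 0 <= x <= 1 ->
  affinity_bound (v.+1%:R)^-1 x b ->
  exists P : probability (X * bool)%type R,
    best_risk G P = ((1 - x) / 2)%:E /\
    ((x * b / 2)%:E <= excess_risk G P ghat)%E.
Proof.
move=> x01 Hb; pose m (_ : 'I_v.+1) : R := (v.+1%:R)^-1.
have m1 (y : R) : \sum_i m i * y = y.
  by rewrite /m sumr_const card_ord -[LHS]mulr_natl mulrA divff ?mul1r// pnatr_eq0.
have [||||P [bP eP]] := excess_risk_ge shatter mghat (m := m) (x := fun=> x)
    _ _ _ (beta := fun=> b).
- by move=> i; rewrite /m invr_ge0.
- by rewrite -[RHS](m1 1); apply: eq_bigr => i _; rewrite mulr1.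
- by [].
- move=> i s; apply: affinity_boundP => //.
  + by move=> j; rewrite /m invr_ge0.
  + by rewrite -[RHS](m1 1); apply: eq_bigr => j _; rewrite mulr1.
exists P; split.
  rewrite bP; congr EFin; rewrite -[RHS]m1.
  by apply: eq_bigr => i _; rewrite mulrA.
apply: le_trans eP; rewrite lee_fin -[leLHS]m1 le_eqVlt; apply/orP; left; apply/eqP.
by apply: eq_bigr => i _; rewrite !mulrA.
Qed.

(** The point [ord0] takes the mass left by v light points; its bias y is a free parameter that sets
    the best risk. *)
Lemma excess_risk_pointed (w x y b : R) : 0 <= w -> v%:R * w <= 1 ->
  0 <= x <= 1 -> 0 <= y <= 1 -> affinity_bound w x b ->
  exists P : probability (X * bool)%type R,
    best_risk G P =
      ((1 - v%:R * w) * (1 - y) / 2 + v%:R * w * (1 - x) / 2)%:E /\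
    ((v%:R * w * x * b / 2)%:E <= excess_risk G P ghat)%E.
Proof.
move=> w0 vw1 x01 y01 Hb.
pose m (i : 'I_v.+1) : R := if i == ord0 then 1 - v%:R * w else w.
pose xx (i : 'I_v.+1) : R := if i == ord0 then y else x.
(* The heavy point is given the trivial bound 0, so y does not enter the lower bound. *)
pose bb (i : 'I_v.+1) : R := if i == ord0 then 0 else b.
have sumE (z : R) : \sum_(i < v) z = v%:R * z.
  by rewrite sumr_const card_ord mulr_natl.
have m0 i : 0 <= m i by rewrite /m; case: ifP => _; rewrite ?subr_ge0.
have m1 : \sum_i m i = 1.
  by rewrite big_ord_recl /m eqxx sumE; ring.
have xx01 i : 0 <= xx i <= 1 by rewrite /xx; case: ifP.
have [|P [bP eP]] := excess_risk_ge shatter mghat m0 m1 xx01 (beta := bb).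
  move=> i s; have [i0|i0] := eqVneq i ord0.
    rewrite {1}/bb i0 eqxx sumr_ge0// => t _.
    by rewrite le_min !weight_ge0.
  by apply: affinity_boundP => //; rewrite /m /xx /bb (negbTE i0).
exists P; split.
  by rewrite bP big_ord_recl /m /xx eqxx /= sumE; congr EFin; ring.
apply: le_trans eP; rewrite lee_fin big_ord_recl /m /xx /bb eqxx/= sumE.
lra.
Qed.

End designs.

(** * Elementary inequalities for powers *)

Section numeric.
Context {R : realType}.

(** For n > 0, the base is the inverse of 1 + 1/n, and 1 + 1/n <= exp (1/n). *)
Lemma expR1_pow n : (expR 1)^-1 <= (1 - (n%:R + 1)^-1) ^+ n :> R.
Proof.
case: n => [|n].
  by have := @expR_ge1Dx R 1; rewrite expr0 invf_le1 ?expR_gt0//; lra.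
have n0 : n.+1%:R != 0 :> R by rewrite pnatr_eq0.
have n1 : n.+1%:R + 1 != 0 :> R by rewrite natr1 pnatr_eq0.
have E (N : R) : N != 0 -> N + 1 != 0 -> 1 - (N + 1)^-1 = (1 + N^-1)^-1.
  by move=> N0 N1; field; rewrite N0 N1.
rewrite E// exprVn lef_pV2 ?posrE ?expR_gt0 ?exprn_gt0 ?addr_gt0 ?invr_gt0 ?ltr0n//.
have -> : expR 1 = expR (n.+1%:R^-1) ^+ n.+1 :> R.
  by rewrite -expRM_natl divff.
by apply: lerXn2r; rewrite ?nnegrE ?expR_ge0 ?addr_ge0 ?invr_ge0 ?expR_ge1Dx.
Qed.

Lemma bernoulli_ge n (w : R) : 0 <= w <= 1 -> 1 - n%:R * w <= (1 - w) ^+ n.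
Proof.
move=> /andP[w0 w1]; elim: n => [|n IH]; first by rewrite mul0r subr0.
rewrite exprS -natr1.
have : 0 <= 1 - w by lra.
move=> /ler_wpM2l /(_ _ _ IH) H; apply: le_trans H.
have : 0 <= n%:R * w * w by rewrite !mulr_ge0.
lra.
Qed.

End numeric.

(** * Tuning the designs, with V = v + 2 *)

Section lower_bounds.
Context (R : realType) d (X : measurableType d) (n v : nat)
  (G : set {mfun X >-> bool}) (pt : 'I_v.+2 -> X).
Hypothesis shatter :
  forall b : 'I_v.+2 -> bool, exists2 g, G g & forall i, g (pt i) = b i.
Context (ghat : n.-tuple (X * bool) -> {mfun X >-> bool}).
Hypothesis mghat : is_estimator ghat.

(** Bias 1 makes labels deterministic, hence best risk 0. The mass w = 1 / (n + 1) maximizes w (1 -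
    w)^n; V - 1 such points fit exactly when V - 2 <= n, and otherwise the masses are 1 / V. *)
Lemma lower_bound_zero_error : exists P : probability (X * bool)%type R,
  best_risk G P = 0%:E /\
  ((if (v <= n)%N then (v.+2%:R - 1) / (2 * expR 1 * (n%:R + 1))
    else 1 / 2 * (1 - 1 / v.+2%:R) ^+ n)%:E <= excess_risk G P ghat)%E.
Proof.
have o1 : 0 <= (1 : R) <= 1 by rewrite ler01 lexx.
case: ifPn => [vn|_].
- pose w : R := (n%:R + 1)^-1.
  have n1 : 0 < n%:R + 1 :> R by rewrite natr1 ltr0n.
  have w0 : 0 <= w by rewrite invr_ge0 ltW.
  have vw : v.+1%:R * w <= 1 by rewrite ler_pdivrMr// mul1r natr1 ler_nat.
  have [|P [bP eP]] := excess_risk_pointed shatter mghat w0 vw o1 o1 (b := (1 - w) ^+ n).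
    by left.
  exists P; split; first by rewrite bP; congr EFin; ring.
  apply: le_trans eP; rewrite lee_fin.
  have -> : (v.+2%:R - 1) / (2 * expR 1 * (n%:R + 1)) =
      v.+1%:R * w * 1 / 2 * (expR 1)^-1 :> R.
    have e0 : expR 1 != 0 :> R by rewrite gt_eqF ?expR_gt0.
    by rewrite -(natr1 v.+1) /w; field; rewrite e0 gt_eqF.
  rewrite [leRHS]mulrAC ler_wpM2l ?expR1_pow//.
  by rewrite mulr1 divr_ge0// mulr_ge0.
- have [|P [bP eP]] := excess_risk_uniform shatter mghat o1 (b := (1 - v.+2%:R^-1) ^+ n).
    by left.
  exists P; split; first by rewrite bP subrr mul0r.
  by apply: le_trans eP; rewrite lee_fin !mul1r mulrC.
Qed.

(** With r = sqrt (V / n), bias r / 2 and u = 1 / 2 give r / 8. For r > 2 that bias exceeds 1, so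
    bias 1 and the chance of missing a point are used instead. *)
Lemma lower_bound_sqrt : (v.+2 <= 13 * n)%N ->
  exists P : probability (X * bool)%type R,
    ((1 / 8 * Num.sqrt (v.+2%:R / n%:R))%:E <= excess_risk G P ghat)%E.
Proof.
move=> vn; pose V : R := v.+2%:R; pose r := Num.sqrt (V / n%:R).
have V0 : 0 < V by rewrite ltr0n.
have n0 : 0 < n%:R :> R by rewrite ltr0n; case: n vn.
have rE : r ^+ 2 = V / n%:R by rewrite sqr_sqrtr// divr_ge0// ltW.
have r0 : 0 < r by rewrite sqrtr_gt0 divr_gt0.
have nV : n%:R * V^-1 * r ^+ 2 = 1 by rewrite rE; field; rewrite !gt_eqF.
have [r2|r2] := leP r 2.
- have x01 : 0 <= r / 2 <= 1 by apply/andP; split; lra.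
  have [|P [_ eP]] := excess_risk_uniform shatter mghat x01 (b := 1 - 1 / 2).
    right; exists (1 / 2) => //; split => //.
    by rewrite expr_div_n mulrA nV; lra.
  by exists P; apply: le_trans eP; rewrite lee_fin -/V -/r; lra.
- have o1 : 0 <= (1 : R) <= 1 by rewrite ler01 lexx.
  have [|P [_ eP]] := excess_risk_uniform shatter mghat o1 (b := (1 - V^-1) ^+ n).
    by left.
  exists P; apply: le_trans eP; rewrite lee_fin -/V -/r.
  have V1 : 0 <= V^-1 <= 1.
    by rewrite invr_ge0 (ltW V0)/= invf_le1// ler1n.
  have := bernoulli_ge n V1.
  have r13 : r ^+ 2 <= 13.
    by rewrite rE ler_pdivrMr// -natrM ler_nat.
  have rr : r ^+ 2 != 0 by rewrite sqrf_eq0 gt_eqF.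
  have -> : n%:R * V^-1 = r ^- 2 by apply: (mulIf rr); rewrite nV mulVf.
  suff : r / 4 <= 1 - r ^- 2 by lra.
  rewrite lerBrDr -lerBrDl -(ler_pM2r (exprn_gt0 2 r0)) mulVf//.
  have r3 : r <= 361 / 100 by rewrite expr2 in r13; nra.
  (* What remains is r^3 - 4 r^2 + 4 <= 0. The third root -161/100 makes the roots sum to 4,
     matching the coefficient of r^2. *)
  have : 0 <= (r - 2) * (361 / 100 - r) * (r + 161 / 100).
    by apply: mulr_ge0; [apply: mulr_ge0|]; lra.
  nra.
Qed.

Lemma lower_bound_positive_error (L : R) : 0 < L <= 1 / 2 ->
  exists P : probability (X * bool)%type R,
    best_risk G P = L%:E /\
    ((if 4 / 9 <= (1 - 2 * L) ^+ 2 * n%:R / v.+2%:R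
      then Num.max (Num.sqrt (L * (v.+2%:R - 1) / (32 * n%:R)))
                   (2 * (v.+2%:R - 1) / (27 * n%:R))
      else (1 - 2 * L) / 6)%:E <= excess_risk G P ghat)%E.
Proof.
move=> /andP[L0 L2].
have DE : 1 - 2 * L >= 0 by lra.
have Vpos : 0 < v.+2%:R :> R by rewrite ltr0n.
case: ifPn => [cond|]; last first.
  rewrite -ltNge => cond.
  have D01 : 0 <= 1 - 2 * L <= 1 by apply/andP; split; lra.
  (* Bias 1 - 2 L gives best risk L; the failed threshold 4 / 9 is u^2 for u = 2 / 3. *)
  have [|P [bP eP]] := excess_risk_uniform shatter mghat D01 (b := 1 - 2 / 3).
    right; exists (2 / 3) => //; split => //.
    have -> : n%:R * v.+2%:R^-1 * (1 - 2 * L) ^+ 2 =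
      (1 - 2 * L) ^+ 2 * n%:R / v.+2%:R by ring.
    by rewrite (le_trans (ltW cond))// expr2; lra.
  exists P; split; first by rewrite bP; congr EFin; field.
  by apply: le_trans eP; rewrite lee_fin; lra.
have [M ME] : exists M : R, M = v.+1%:R by exists v.+1%:R.
have [N NE] : exists N : R, N = n%:R by exists n%:R.
rewrite -NE in cond *; pose D := 1 - 2 * L.
have VE : v.+2%:R = M + 1 by rewrite ME natr1.
have N0 : 0 < N.
  rewrite lt_neqAle {2}NE ler0n andbT; apply/eqP => n0; move: cond.
  by rewrite -n0 mulr0 mul0r; lra.
have M0 : 0 < M by rewrite ME ltr0n.
have NM : 4 * (M + 1) <= 9 * (D ^+ 2 * N).
  by move: cond; rewrite ler_pdivlMr// VE -/D; lra.
have D0 : 0 < D.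
  rewrite lt_neqAle DE andbT; apply/eqP => d0.
  by move: NM; rewrite -d0 expr0n mul0r; lra.
have D2 : D ^+ 2 <= D by rewrite /D expr2; nra.
have N0' : N != 0 by rewrite gt_eqF.
have M0' : M != 0 by rewrite gt_eqF.
rewrite VE addrK.
set A := Num.sqrt _; set B := 2 * M / _.
have [AB|BA] := leP A B.
(* With bias 1 on the light points, this is N w = (2 / 3)^2. The heavy point alone then produces the
   best risk L. *)
- pose w := 4 / (9 * N).
  have w0 : 0 <= w by rewrite divr_ge0// mulr_ge0// ltW.
  have MwD : M * w <= D.
    rewrite /w mulrA ler_pdivrMr ?mulr_gt0//.
    have : D ^+ 2 * N <= D * N by rewrite ler_pM2r.
    lra.
  have r0 : 0 < 1 - M * w by rewrite /D in MwD; lra.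
  have y01 : 0 <= 1 - 2 * L / (1 - M * w) <= 1.
    rewrite gerBl subr_ge0 ler_pdivrMr// mul1r divr_ge0 ?(ltW r0)//; last lra.
    by rewrite andbT; rewrite /D in MwD; lra.
  have Mw1 : v.+1%:R * w <= 1 by rewrite -ME; lra.
  have o1 : 0 <= (1 : R) <= 1 by rewrite ler01 lexx.
  have [|P [bP eP]] := excess_risk_pointed shatter mghat w0 Mw1 o1 y01 (b := 1 - 2 / 3).
    right; exists (2 / 3) => //; split => //.
    by rewrite -NE /w (_ : N * _ * _ = (2 / 3) ^+ 2)//; field.
  exists P; split.
    have E (r : R) : r != 0 -> r * (1 - (1 - 2 * L / r)) / 2 = L.
      by move=> rn0; field.
    by rewrite bP -ME E ?gt_eqF// subrr mulr0 mul0r addr0.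
  apply: le_trans eP; rewrite lee_fin -ME /B /w le_eqVlt; apply/orP; left.
  by apply/eqP; field.
- have B0 : 0 <= B by rewrite divr_ge0 ?mulr_ge0// ltW.
  have LM : 0 <= L * M / (32 * N) by rewrite divr_ge0 ?mulr_ge0// ltW.
  (* Squaring B < A gives 128 M < 729 N L, which is enough for the bias x below to be at most 1. *)
  have M8 : M <= 8 * N * L.
    have : B ^+ 2 < L * M / (32 * N) by rewrite -(sqr_sqrtr LM) ltr_pXn2r// nnegrE sqrtr_ge0.
    have -> : B ^+ 2 = 128 * M / (729 * N) * (M / (32 * N)) by rewrite /B; field.
    have -> : L * M / (32 * N) = L * (M / (32 * N)) by rewrite mulrA.
    have s0 : 0 < M / (32 * N) by apply: divr_gt0 => //; apply: mulr_gt0.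
    have t0 : 0 < 729 * N by lra.
    rewrite (ltr_pM2r s0) (ltr_pdivrMr _ _ t0).
    lra.
  have q0 : 0 <= M / (8 * N * L) by rewrite divr_ge0 ?mulr_ge0// ltW.
  pose x := Num.sqrt (M / (8 * N * L)).
  have L0' : L != 0 by rewrite gt_eqF.
  have xE : x ^+ 2 = M / (8 * N * L) by rewrite sqr_sqrtr.
  have x0 : 0 <= x by rewrite sqrtr_ge0.
  have x1 : x <= 1.
    by rewrite -(@expr_le1 _ 2)// xE ler_pdivrMr ?mul1r// !mulr_gt0.
  (* This makes y nonnegative; it follows from L <= 1 / 2 and the threshold on n. *)
  have LxD : 2 * L * x <= D.
    have p0 : 0 <= 2 * L * x by rewrite !mulr_ge0// ltW.
    rewrite -(@ler_pXn2r _ 2) ?nnegrE// exprMn xE.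
    have -> : (2 * L) ^+ 2 * (M / (8 * N * L)) = L * M / (2 * N).
      by field; rewrite ?L0' ?M0' ?N0'.
    rewrite ler_pdivrMr ?mulr_gt0//.
    have : L * M <= 1 / 2 * M by rewrite ler_pM2r.
    lra.
  (* The light points have total mass 2 L and contribute L (1 - x) to the best risk; the heavy one
     supplies the missing L x. Here N w x^2 = (1 / 2)^2, so the excess is at least L x / 2 = A. *)
  pose w := 2 * L / M.
  have MwE : M * w = 2 * L by rewrite /w; field.
  have w0 : 0 <= w by rewrite divr_ge0 ?mulr_ge0// ltW.
  have Mw1 : v.+1%:R * w <= 1 by rewrite -ME MwE; lra.
  have y01 : 0 <= 1 - 2 * L * x / D <= 1.
    by rewrite gerBl subr_ge0 ler_pdivrMr// mul1r LxD divr_ge0 ?mulr_ge0// ltW.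
  have x01 : 0 <= x <= 1 by rewrite x0.
  have [|P [bP eP]] := excess_risk_pointed shatter mghat w0 Mw1 x01 y01 (b := 1 - 1 / 2).
    right; exists (1 / 2) => //; split => //.
    by rewrite xE -NE /w (_ : N * _ * _ = (1 / 2) ^+ 2)//; field; rewrite ?L0' ?M0' ?N0'.
  exists P; split.
    rewrite bP; congr EFin; rewrite -ME MwE -/D.
    have -> : D * (1 - (1 - 2 * L * x / D)) / 2 = L * x by field; rewrite gt_eqF.
    by lra.
  apply: le_trans eP; rewrite lee_fin -ME MwE.
  have -> : 2 * L * x * (1 - 1 / 2) / 2 = L * x / 2 by field.
  rewrite -(@ler_pXn2r _ 2) ?nnegrE ?sqrtr_ge0//; last by rewrite divr_ge0// mulr_ge0// ltW.
  rewrite sqr_sqrtr// expr_div_n exprMn xE le_eqVlt; apply/orP; left; apply/eqP.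
  by field; rewrite ?L0' ?M0' ?N0'.
Qed.

End lower_bounds.

(* The third part carries the guard V <= 13 n: as the excess risk is at most 1,
   a lower bound sqrt(V / n) / 8 cannot hold when V > 64 n. *)
Theorem theorem8p9 (R : realType) (d : measure_display) (X : measurableType d)
    (L : R) (n : nat) (G : set {mfun X >-> bool}) (V : nat)
    (hL : 0 <= L <= 1 / 2) (hG : is_vc_dimension G V) (hV : (2 <= V)%N)
    (ghat : n.-tuple (X * bool) -> {mfun X >-> bool})
    (hghat : is_estimator ghat) :
  [/\ (L = 0 ->
        exists P : probability (X * bool)%type R,
          best_risk G P = 0%:E /\
          ((if (V - 2 <= n)%N
            then (V%:R - 1) / (2 * expR 1 * (n%:R + 1))
            else 1 / 2 * (1 - 1 / V%:R) ^+ n)%:E <= excess_risk G P ghat)%E),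
      (0 < L ->
        exists P : probability (X * bool)%type R,
          best_risk G P = L%:E /\
          ((if 4 / 9 <= (1 - 2 * L) ^+ 2 * n%:R / V%:R
            then Num.max (Num.sqrt (L * (V%:R - 1) / (32 * n%:R)))
                         (2 * (V%:R - 1) / (27 * n%:R))
            else (1 - 2 * L) / 6)%:E <= excess_risk G P ghat)%E) &
      ((V <= 13 * n)%N ->
        exists P : probability (X * bool)%type R,
          ((1 / 8 * Num.sqrt (V%:R / n%:R))%:E <= excess_risk G P ghat)%E)].
Proof.
case: V hV hG => [|[|v]]// _ [[pt [_ shatter]] _].
have /andP[_ L2] := hL.
split=> [_|L0|].
- rewrite !subSS subn0; exact (lower_bound_zero_error R shatter hghat).
- by apply: (lower_bound_positive_error shatter hghat); rewrite L0 L2.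
- exact: (lower_bound_sqrt R shatter hghat).
Qed.
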